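(* Let $p\ge 2$ be fixed and let $1\le\alpha\le 2$. Then for every complex sequence $\mathbf{a}=(a_n)_{n\ge1}\in l^p$, $$\sum_{n=1}^{\infty}\Big|\frac{1}{\sum_{i=1}^n i^{\alpha-1}}\sum_{i=1}^n i^{\alpha-1}a_i\Big|^p\le\Big(\frac{\alpha p}{\alpha p-1}\Big)^p\sum_{n=1}^\infty|a_n|^p.$$
   Context: $l^p$ is the space of complex sequences $\mathbf{a}=(a_n)_{n\ge1}$ with $\sum_{n=1}^\infty|a_n|^p<\infty$. *)

(* Defs.v *)
From mathcomp Require Import all_boot all_order all_algebra.
From mathcomp Require Import all_classical all_reals all_analysis.
From mathcomp Require Import complex.

Set Implicit Arguments.
Unset Strict Implicit.
Unset Printing Implicit Defensive.

Import Order.TTheory GRing.Theory Num.Theory.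

Local Open Scope ring_scope.
Local Open Scope complex_scope.

(* A complex sequence (a_n)_{n >= 1} is a function nat -> R[i]; all sums start
   at 1, so the value at 0 is never used. The modulus is the R-valued [normc],
   since `|z| : R[i].
   Series of nonnegative terms are summed in \bar R: the sum of a divergent
   one is +oo. *)

Definition sum_pow (R : realType) (p : R) (a : nat -> R[i]) : \bar R :=
  (\sum_(1 <= n <oo) (Normc.normc (a n) `^ p)%:E)%E.

Definition in_lp (R : realType) (p : R) (a : nat -> R[i]) : Prop :=
  (sum_pow p a < +oo)%E.

Definition weighted_mean (R : realType) (alpha : R) (a : nat -> R[i])
    (n : nat) : R[i] :=
  (\sum_(1 <= i < n.+1) i%:R `^ (alpha - 1))%:C^-1 *
  \sum_(1 <= i < n.+1) (i%:R `^ (alpha - 1))%:C * a i.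

(* Main.v *)
Require Import Defs.
From mathcomp Require Import all_boot all_order all_algebra.
From mathcomp Require Import all_classical all_reals all_analysis.
From mathcomp Require Import complex ring lra.

Set Implicit Arguments.
Unset Strict Implicit.
Unset Printing Implicit Defensive.

Import Order.TTheory GRing.Theory Num.Theory.

Local Open Scope ring_scope.
Local Open Scope complex_scope.

(** With [lam i = i^s], [s = alpha - 1], [Lam n = lam 1 + ... + lam n] and
    [x n = Lam n / lam n], the averages satisfy
    [x n * A n = b n + (x n - 1) * A (n - 1)].  For [l = L / p], convexity of
    [t^p] with the weight [(1 - l) / (x n - l)] on [b n] gives a one-step
    inequality which telescopes to Hardy's inequality with constant
    [(1 - l)^-p], provided [x (n+1) - l <= (x n)^p / (x n - l)^(p-1)].
    For [p >= 2] this criterion follows from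
    [x (n+1) <= x n + L + L^2 / (4 x n)].  The quadratic term matters: with
    [L = 1 / alpha], Cartlidge's condition [x (n+1) <= x n + L] already fails
    at [n = 1] when [1 < alpha < 2].  The weaker condition is checked from
    [n (n+1)^s <= (s+1) Lam n], [Lam n <= n^(s+1)] and a second-order Bernoulli
    inequality at [1/n]. *)

(** * Convexity and the telescoping argument *)

Lemma powR_convex_comb {R : realType} (p t u v : R) :
  1 <= p -> 0 <= t <= 1 -> 0 <= u -> 0 <= v ->
  (t * u + (1 - t) * v) `^ p <= t * u `^ p + (1 - t) * v `^ p.
Proof.
move=> p1 /andP[t0 t1] u0 v0.
have := @convex_powR R p p1 (Itv01 t0 t1) u v.
rewrite !inE /= !in_itv /= !andbT => /(_ u0 v0).
by rewrite !convRE.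
Qed.

(** With [t = (1 - l) / (x - l)], the numerator is [x - l] times the convex combination of
    [b / (1 - l)] and [B]. Since [(x - l) * t = 1 - l] and [(x - l) * (1 - t) = x - 1], convexity
    gives exactly the two terms on the right. *)
Lemma hardy_step {R : realType} (p l x b B : R) :
  1 <= p -> 0 <= l < 1 -> 1 <= x -> 0 <= b -> 0 <= B ->
  (1 - l)^-1 * (x `^ p / (x - l) `^ (p - 1))
      * ((b + (x - 1) * B) / x) `^ p
    <= (1 - l)^-1 `^ p * b `^ p + (1 - l)^-1 * (x - 1) * B `^ p.
Proof.
move=> p1 /andP[l0 l1] x1 b0 B0.
have xl : 0 < x - l by lra.
have k0 : 0 < (1 - l)^-1 by rewrite invr_gt0; lra.
have x0 : 0 < x by lra.
have num0 : 0 <= b + (x - 1) * B by rewrite addr_ge0// mulr_ge0//; lra.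
rewrite powRM// ?invr_ge0; [|lra].
rewrite -(powR_inv1 (ltW x0)) powRAC powR_inv1 ?powR_ge0//.
set t := (1 - l) / (x - l).
have t01 : 0 <= t <= 1.
  by rewrite /t ler_pdivlMr// ler_pdivrMr// mul0r mul1r; lra.
have -> : b + (x - 1) * B = (x - l) * (t * ((1 - l)^-1 * b) + (1 - t) * B).
  by rewrite /t; field; rewrite !gt_eqF; lra.
rewrite powRM ?(ltW xl)//; last first.
  case/andP: t01 => t0 t1; apply: addr_ge0; repeat (apply: mulr_ge0 => //);
    by rewrite ?(ltW k0)// subr_ge0.
have -> : (x - l) `^ p = (x - l) * (x - l) `^ (p - 1).
  by rewrite mulr_powRB1// ?(ltW xl)//; lra.
have := @powR_convex_comb R p t _ B p1 t01 (mulr_ge0 (ltW k0) b0) B0.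
rewrite powRM ?(ltW k0)// => H.
have xp : x `^ p != 0 by rewrite gt_eqF// powR_gt0.
have xlp : (x - l) `^ (p - 1) != 0 by rewrite gt_eqF// powR_gt0.
set S := (_ + _) `^ p in H *.
have -> : (1 - l)^-1 * (x `^ p / (x - l) `^ (p - 1)) *
    ((x - l) * (x - l) `^ (p - 1) * S / x `^ p) = (1 - l)^-1 * (x - l) * S.
  by field; rewrite xp xlp gt_eqF//; lra.
apply: le_trans (ler_wpM2l _ H) _; first by rewrite mulr_ge0// ltW.
rewrite le_eqVlt; apply/orP; left; apply/eqP; rewrite /t.
by field; rewrite !gt_eqF; lra.
Qed.

Lemma weighted_hardy {R : realType} (p l : R) (lam b : nat -> R) :
  let Lam n := \sum_(1 <= i < n.+1) lam i in
  let A n := (Lam n)^-1 * \sum_(1 <= i < n.+1) lam i * b i in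
  1 <= p -> 0 <= l < 1 ->
  (forall n, (0 < n)%N -> 0 < lam n) -> (forall n, 0 <= b n) ->
  (forall n, (0 < n)%N ->
     Lam n.+1 / lam n.+1 - l
       <= (Lam n / lam n) `^ p / (Lam n / lam n - l) `^ (p - 1)) ->
  forall N, \sum_(1 <= n < N.+1) A n `^ p
    <= (1 - l)^-1 `^ p * \sum_(1 <= n < N.+1) b n `^ p.
Proof.
move=> Lam A p1 l01 lam0 b0 crit.
have LamS n : Lam n.+1 = Lam n + lam n.+1 by rewrite /Lam big_nat_recr.
have Lam0 n : 0 <= Lam n.
  elim: n => [|n IH]; first by rewrite /Lam big_geq.
  by rewrite LamS addr_ge0// ltW// lam0.
have A0 n : 0 <= A n.
  rewrite /A mulr_ge0 ?invr_ge0// big_nat_cond sumr_ge0// => i.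
  by rewrite andbT => /andP[i1 _]; rewrite mulr_ge0// ltW// lam0.
have x1 n : 1 <= Lam n.+1 / lam n.+1.
  by rewrite ler_pdivlMr ?lam0// mul1r LamS lerDr.
have AS n : A n.+1
    = (b n.+1 + (Lam n.+1 / lam n.+1 - 1) * A n) / (Lam n.+1 / lam n.+1).
  have ln0 : lam n.+1 != 0 by rewrite gt_eqF ?lam0.
  have LnS0 : Lam n.+1 != 0 by rewrite gt_eqF// LamS ltr_wpDl ?lam0.
  have -> : A n.+1 = (Lam n.+1)^-1 * (Lam n * A n + lam n.+1 * b n.+1).
    rewrite /A [\sum_(1 <= i < n.+2) _]big_nat_recr//=; congr (_ * (_ + _)).
    (* [Lam n] vanishes only for [n = 0], where the weighted sum is empty too. *)
    have [Ln0|Ln0] := eqVneq (Lam n) 0; last by rewrite mulVKf.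
    rewrite Ln0 mul0r; case: n Ln0 {ln0 LnS0} => [|n Ln0].
      by rewrite big_geq.
    by have := lam0 n.+1 isT; have := Lam0 n; move: Ln0; rewrite LamS; lra.
  have -> : Lam n = Lam n.+1 - lam n.+1 by rewrite LamS addrK.
  by field; rewrite LnS0 ln0.
move: (l01) => /andP[l0 l1].
have K0 : 0 < (1 - l)^-1 by rewrite invr_gt0; lra.
(* The induction carries the boundary term that [hardy_step] consumes at the next index. *)
suff main N : \sum_(1 <= n < N.+1) A n `^ p
      + (1 - l)^-1 * (Lam N.+1 / lam N.+1 - 1) * A N `^ p
    <= (1 - l)^-1 `^ p * \sum_(1 <= n < N.+1) b n `^ p.
  move=> N; apply: le_trans (main N); rewrite lerDl.
  by rewrite !mulr_ge0 ?powR_ge0 ?(ltW K0)// subr_ge0.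
elim: N => [|N IH].
  rewrite !big_geq// mulr0 add0r /A big_geq// mulr0 powR0 ?mulr0//.
  by rewrite gt_eqF//; lra.
rewrite [\sum_(1 <= n < N.+2) A n `^ p]big_nat_recr//=.
rewrite [\sum_(1 <= n < N.+2) b n `^ p]big_nat_recr//=.
have := hardy_step p1 l01 (x1 N) (b0 N.+1) (A0 N); rewrite -AS.
have := ler_wpM2r (powR_ge0 (A N.+1) p) (ler_wpM2l (ltW K0) (crit N.+1 isT)).
set Y := _ / _ - l in IH *.
have -> : Lam N.+2 / lam N.+2 = Y + l by rewrite /Y subrK.
have -> : (1 - l)^-1 * (Y + l - 1) = (1 - l)^-1 * Y - 1.
  by field; rewrite gt_eqF//; lra.
move: IH; set a1 := A N.+1 `^ p; set S := \sum_(1 <= n < _) _.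
set S' := \sum_(1 <= n < _) _.
rewrite mulrDr mulrBl mul1r; lra.
Qed.

(** * Inequalities of Bernoulli type *)

Lemma powR_bernoulli_le {R : realType} (s t : R) :
  0 <= s <= 1 -> 0 <= t -> (1 + t) `^ s <= 1 + s * t.
Proof.
move=> s01 t0.
have [->|s0] := eqVneq s 0; first by rewrite powRr0 mul0r addr0.
have [->|s1] := eqVneq s 1; first by rewrite powRr1 ?mul1r; lra.
have {}s01 : 0 < s < 1 by move: s01; rewrite !lt_neqAle eq_sym s0 s1.
have := @conjugate_powR R ((1 + t) `^ s) 1 s^-1 (1 - s)^-1.
rewrite -powRrM mulfV// powRr1 ?powR1 ?invrK; last by lra.
rewrite mulr1 !invr_gt0 => /(_ (powR_ge0 _ _) ler01).
by move=> /(_ ltac:(lra) ltac:(lra) ltac:(lra)); lra.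
Qed.

(** The concave case with exponent [1 / r] at the point [r * t], raised to the power [r]. *)
Lemma powR_bernoulli_ge {R : realType} (r t : R) :
  1 <= r -> 0 <= t -> 1 + r * t <= (1 + t) `^ r.
Proof.
move=> r1 t0; have r0 : 0 < r by lra.
have rt0 : 0 <= r * t by rewrite mulr_ge0// ltW.
have r01 : 0 <= r^-1 <= 1 by rewrite invr_ge0 (ltW r0) invf_le1.
have := powR_bernoulli_le r01 rt0.
rewrite mulKf ?gt_eqF// => /(@ge0_ler_powR R r (ltW r0)).
rewrite !nnegrE powR_ge0 => /(_ isT ltac:(lra)).
by rewrite -powRrM mulVf ?gt_eqF// powRr1; lra.
Qed.

Lemma powR_bernoulli2_ge {R : realType} (s t : R) : 0 <= s <= 1 -> 0 <= t ->
  1 + s * t - s * (1 - s) / 2 * t ^+ 2 <= (1 + t) `^ s.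
Proof.
move=> s01 t0.
pose f (u : R) := u `^ s - (s * u - s * (1 - s) / 2 * (u - 1) ^+ 2).
pose df (u : R) := s * u `^ (s - 1) - (s - s * (1 - s) * (u - 1)).
have fD (u : R) : 0 < u -> is_derive u 1 f (df u).
  move=> u0; rewrite /f /df.
  have := is_derive1_powR s u0 => ?.
  apply: is_derive_eq.
  rewrite /GRing.scale /=; by field.
have u0 (u : R) : 1 <= u -> 0 < u by apply: lt_le_trans.
have [|x /itvP xI||c] := @MVT_segment R f df 1 (1 + t).
- by rewrite lerDl.
- by apply: fD; apply: u0; rewrite xI.
- apply: derivable_within_continuous => x /itvP xI.
  by apply: ex_derive; apply: fD; apply: u0; rewrite xI.
rewrite in_itv/= => /andP[c1 _].
suff df0 : 0 <= df c.
  move=> E; have : 0 <= f (1 + t) - f 1 by rewrite E mulr_ge0//; lra.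
  by rewrite /f powR1 !expr2; lra.
rewrite /df -subr_ge0.
have v0 : 0 <= (1 - s) * (c - 1) by rewrite mulr_ge0//; lra.
have H : (1 + (c - 1)) `^ (1 - s) <= 1 + (1 - s) * (c - 1).
  by apply: powR_bernoulli_le; lra.
rewrite addrC subrK in H.
(* With [v = (1 - s) * (c - 1)], this is [1 - v <= 1 / (1 + v)] combined with [H]. *)
have : 1 - (1 - s) * (c - 1) <= c `^ (s - 1).
  rewrite -[s - 1]opprB powRN.
  have cp : 0 < c `^ (1 - s) by rewrite powR_gt0; lra.
  rewrite -[leRHS]div1r ler_pdivlMr//.
  have [?|?] := leP (1 - (1 - s) * (c - 1)) 0; first by nra.
  nra.
move=> /(ler_wpM2l (proj1 (andP s01))); nra.
Qed.

Lemma hardy_increment_suff {R : realType} (p L x y : R) :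
  2 <= p -> 0 <= L <= 1 -> 1 <= x -> y <= x + L + L ^+ 2 / (4 * x) ->
  y - L / p <= x `^ p / (x - L / p) `^ (p - 1).
Proof.
move=> p2 /andP[L0 L1] x1 yle.
have p0 : 0 < p by lra.
set l := L / p; have Lp : L = p * l by rewrite /l mulrC divfK ?gt_eqF.
have l0 : 0 <= l by rewrite divr_ge0// ltW.
have l1 : l < 1 by rewrite ltr_pdivrMr// mul1r; lra.
have xl : 0 < x - l by lra.
pose w := l / (x - l); have w0 : 0 <= w by rewrite divr_ge0// ltW.
have -> : x = (x - l) * (1 + w) by rewrite /w; field; rewrite gt_eqF.
rewrite powRM ?(ltW xl)//; last by lra.
have -> : (x - l) * (1 + w) - l = x - l by rewrite /w; field; rewrite gt_eqF.
rewrite -(@mulr_powRB1 _ (x - l) p) ?(ltW xl)//.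
have -> : (x - l) * (x - l) `^ (p - 1) * (1 + w) `^ p / (x - l) `^ (p - 1)
    = (x - l) * (1 + w) `^ p.
  by field; rewrite gt_eqF// powR_gt0.
(* Squaring Bernoulli's inequality for the exponent p/2 >= 1 yields the
   quadratic term with the constant 1/4, uniformly in p. *)
have -> : (1 + w) `^ p = ((1 + w) `^ (p / 2)) ^+ 2.
  by rewrite -powR_mulrn ?powR_ge0// -powRrM divfK.
have H : 1 + p / 2 * w <= (1 + w) `^ (p / 2) by apply: powR_bernoulli_ge; lra.
have pw0 : 0 <= 1 + p / 2 * w by rewrite addr_ge0// mulr_ge0//; lra.
have := lerXn2r 2 pw0 (powR_ge0 _ _) H.
move=> /(ler_wpM2l (ltW xl)); apply: le_trans.
have -> : (x - l) * (1 + p / 2 * w) ^+ 2 = x - l + L + L ^+ 2 / (4 * (x - l)).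
  by rewrite Lp /w; field; rewrite gt_eqF.
apply: le_trans (_ : x - l + L + L ^+ 2 / (4 * x) <= _); first by lra.
rewrite lerD2l ler_wpM2l ?sqr_ge0// lef_pV2 ?posrE; lra.
Qed.

(** * Growth of sums of powers *)

Section PowerSums.
Variables (R : realType) (s : R).
Hypothesis s01 : 0 <= s <= 1.

Let S n : R := \sum_(1 <= i < n.+1) i%:R `^ s.

Let SS n : S n.+1 = S n + n.+1%:R `^ s.
Proof. by rewrite /S big_nat_recr. Qed.

Let powS n : n.+2%:R `^ s = n.+1%:R `^ s * (1 + n.+1%:R^-1) `^ s :> R.
Proof.
rewrite -powRM ?addr_ge0 ?invr_ge0//; congr (_ `^ _).
by rewrite mulrDr mulr1 mulfV// [n.+2%:R]mulrS addrC.
Qed.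

(** Induction: Bernoulli bounds the new left side by [P * (n + 1 + s)], which exceeds the old one by
    [(s + 1) * P]. *)
Lemma power_sum_ge n : n%:R * n.+1%:R `^ s <= (s + 1) * S n.
Proof.
elim: n => [|n IH]; first by rewrite mul0r /S big_geq// mulr0.
rewrite SS powS; set P := _ `^ s in IH *.
have P0 : 0 <= P by exact: powR_ge0.
have m0 : 0 < n.+1%:R :> R by rewrite ltr0n.
have iv0 : 0 <= n.+1%:R^-1 :> R by rewrite invr_ge0.
have /(ler_wpM2l P0) /(ler_wpM2l (ltW m0)) H := powR_bernoulli_le s01 iv0.
apply: le_trans H _.
have -> : n.+1%:R * (P * (1 + s * n.+1%:R^-1)) = P * (n.+1%:R + s).
  by field; rewrite gt_eqF.
by move: IH; rewrite -natr1; lra.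
Qed.

Lemma power_sum_le n : S n <= n%:R * n%:R `^ s.
Proof.
have : S n <= \sum_(1 <= i < n.+1) n%:R `^ s.
  rewrite /S; apply: ler_sum_nat => i /andP[_ lein].
  by rewrite ge0_ler_powR ?nnegrE ?ler_nat//; case/andP: s01.
by rewrite sumr_const_nat subSS subn0 mulr_natl.
Qed.

(** The next ratio is [1 + x / u]. As [1 - L = L * s], the loss of order [y] in bounding [x - x / u]
    below must be absorbed by [L^2 / (4 * x)]; this comes down to [2 * s * (1 - s) <= L]. *)
Lemma power_sum_increment n (x := S n.+1 / n.+1%:R `^ s) :
  S n.+2 / n.+2%:R `^ s <= x + (1 + s)^-1 + (1 + s)^-1 ^+ 2 / (4 * x).
Proof.
case/andP: (s01) => s0 s1.
have m0 : 0 < n.+1%:R :> R by rewrite ltr0n.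
set y : R := n.+1%:R^-1; have y0 : 0 < y by rewrite invr_gt0.
set P := n.+1%:R `^ s in x *; have P0 : 0 < P by rewrite powR_gt0.
set u := (1 + y) `^ s; have u0 : 0 < u by rewrite powR_gt0//; lra.
have u2 : 1 + s * y - s * (1 - s) / 2 * y ^+ 2 <= u.
  by apply: powR_bernoulli2_ge => //; rewrite ltW.
set L := (1 + s)^-1; have L0 : 0 < L by rewrite invr_gt0; lra.
have -> : S n.+2 / n.+2%:R `^ s = 1 + x / u.
  rewrite SS powS -/P -/y -/u /x; field.
  by rewrite !gt_eqF.
have xy : x <= y^-1.
  by rewrite /x /y invrK ler_pdivrMr//; exact: power_sum_le.
have xu : L / y <= x / u.
  rewrite ler_pdivlMr// /x ler_pdivlMr// /L /y invrK.
  rewrite -!mulrA ler_pdivrMl ?(mulrC u); last by lra.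
  by rewrite [1 + s]addrC (le_trans _ (power_sum_ge n.+1))// powS.
have x0 : 0 < x.
  have : 0 < x / u by apply: lt_le_trans xu; rewrite divr_gt0.
  by rewrite pmulr_lgt0// invr_gt0.
have H1 : L ^+ 2 * y / 4 <= L ^+ 2 / (4 * x).
  rewrite -mulrA ler_wpM2l ?sqr_ge0// invfM mulrC ler_wpM2l//.
  by rewrite -[y]invrK lef_pV2 ?posrE// invr_gt0.
have H2 : L * (s - s * (1 - s) / 2 * y) <= x - x / u.
  have -> : x - x / u = x / u * (u - 1) by field; rewrite gt_eqF.
  have u1 : 1 <= u.
    have -> : 1 = 1 `^ s by rewrite powR1.
    by rewrite ge0_ler_powR ?nnegrE; lra.
  apply: le_trans (ler_wpM2r (_ : 0 <= u - 1) xu); last by lra.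
  have -> : L / y * (u - 1) = L * ((u - 1) / y) by rewrite mulrAC mulrA.
  rewrite ler_wpM2l ?(ltW L0)// ler_pdivlMr//.
  by move: u2; rewrite expr2; lra.
have LE : L = 1 - L * s by rewrite /L; field; rewrite gt_eqF//; lra.
(* The cubic [2 * s * (1 - s) * (1 + s)] peaks at [1 / sqrt 3], close to [3 / 5]; the first square
   reduces the claim to a quadratic with vertex [17 / 30]. *)
have H3 : 2 * s * (1 - s) <= L.
  rewrite /L -[leRHS]div1r ler_pdivlMr; last by lra.
  have := mulr_ge0 s0 (sqr_ge0 (s - 3 / 5)).
  have := sqr_ge0 (s - 17 / 30); rewrite !expr2; lra.
have := ler_wpM2l (mulr_ge0 (ltW L0) (ltW y0)) H3; rewrite expr2 in H1.
lra.
Qed.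

End PowerSums.

(** * Reduction to moduli and passage to infinite series *)

Lemma normc_ge0 {R : realType} (z : R[i]) : 0 <= Normc.normc z.
Proof. by case: z => a b /=; exact: sqrtr_ge0. Qed.

Lemma normc_sum_le {R : realType} (F : nat -> R[i]) m n :
  Normc.normc (\sum_(m <= i < n) F i) <= \sum_(m <= i < n) Normc.normc (F i).
Proof.
elim/big_ind2: _ => [|z1 r1 z2 r2 H1 H2|//]; first by rewrite Normc.normc0.
by apply: le_trans (le_normcD _ _) _; exact: lerD.
Qed.

Lemma normc_real {R : realType} (r : R) : 0 <= r -> Normc.normc r%:C = r.
Proof. by move=> r0 /=; rewrite expr0n addr0 sqrtr_sqr ger0_norm. Qed.

Lemma normc_weighted_mean_le {R : realType} (alpha : R) (a : nat -> R[i]) n :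
  Normc.normc (weighted_mean alpha a n)
    <= (\sum_(1 <= i < n.+1) i%:R `^ (alpha - 1))^-1 *
       \sum_(1 <= i < n.+1) i%:R `^ (alpha - 1) * Normc.normc (a i).
Proof.
have S0 : 0 <= \sum_(1 <= i < n.+1) (i%:R : R) `^ (alpha - 1).
  by apply: sumr_ge0 => i _; exact: powR_ge0.
rewrite /weighted_mean Normc.normcM Normc.normcV normc_real//.
rewrite ler_wpM2l ?invr_ge0//; apply: le_trans (normc_sum_le _ _ _) _.
by apply: ler_sum => i _; rewrite Normc.normcM normc_real ?powR_ge0.
Qed.

Theorem theorem6p1 (R : realType) (p : R) (hp : 2 <= p)
    (alpha : R) (halpha1 : 1 <= alpha) (halpha2 : alpha <= 2)
    (a : nat -> R[i]) (ha : in_lp p a) :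
  (sum_pow p (weighted_mean alpha a)
     <= ((alpha * p / (alpha * p - 1)) `^ p)%:E * sum_pow p a)%E.
Proof.
have ap : 1 < alpha * p by nra.
have p0 : 0 < p by lra.
have al0 : 0 < alpha by lra.
(* This is [L / p] with [L = 1 / alpha], the limit of the increments of [Lam n / lam n]. *)
set l := alpha^-1 / p.
have L01 : 0 <= alpha^-1 <= 1 by rewrite invr_ge0 (ltW al0) invf_le1.
have l01 : 0 <= l < 1.
  case/andP: L01 => L0 L1; rewrite /l divr_ge0 ?(ltW p0)//=.
  by rewrite ltr_pdivrMr// mul1r; lra.
have -> : alpha * p / (alpha * p - 1) = (1 - l)^-1.
  rewrite /l; field; rewrite !gt_eqF//; lra.
pose lam (i : nat) : R := i%:R `^ (alpha - 1).
have s01 : 0 <= alpha - 1 <= 1 by lra.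
have lam0 n : (0 < n)%N -> 0 < lam n by move=> n0; rewrite powR_gt0// ltr0n.
have x1 n : 1 <= (\sum_(1 <= i < n.+2) lam i) / lam n.+1.
  rewrite ler_pdivlMr ?lam0// mul1r big_nat_recr//= lerDr sumr_ge0// => i _.
  exact: powR_ge0.
have p1 : 1 <= p by lra.
have partial := weighted_hardy p1 l01 lam0 (fun n => normc_ge0 (a n)).
have {}partial N :
  \sum_(1 <= n < N.+1) Normc.normc (weighted_mean alpha a n) `^ p
    <= (1 - l)^-1 `^ p * \sum_(1 <= n < N.+1) Normc.normc (a n) `^ p.
  apply: le_trans (partial _ N) => [|[//|n] _].
    apply: ler_sum => n _; apply: ge0_ler_powR (normc_weighted_mean_le _ _ _).
    - exact: ltW.
    - by rewrite nnegrE normc_ge0.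
    - by rewrite nnegrE (le_trans (normc_ge0 _) (normc_weighted_mean_le _ _ _)).
  apply: hardy_increment_suff => //.
  have := power_sum_increment s01 n.
  by rewrite [1 + _]addrC subrK.
have term_ge0 (b : nat -> R[i]) n : (0 <= (Normc.normc (b n) `^ p)%:E)%E.
  by rewrite lee_fin powR_ge0.
rewrite /sum_pow; apply: lime_le; first by apply: is_cvg_nneseries.
(* Each partial sum is bounded by the full right side; the bound [partial] starts at upper index 1,
   so the empty range below 0 is separate. *)
apply: nearW => -[|N].
  by rewrite big_geq// mule_ge0// ?lee_fin ?powR_ge0 ?nneseries_ge0.
apply: (@le_trans _ _ (((1 - l)^-1 `^ p)%:E *
    \sum_(1 <= n < N.+1) (Normc.normc (a n) `^ p)%:E)%E).
  by rewrite !sumEFin -EFinM lee_fin.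
by rewrite lee_wpmul2l ?lee_fin ?powR_ge0//; apply: nneseries_lim_ge.
Qed.
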